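(* Consider the Diophantine equation $$L_{n_1}L_{n_2}L_{n_3}\cdots L_{n_k} + 1 = L_m^2$$ in integers $m\geq 0$, $k\geq 1$, and $0\leq n_1\leq n_2 \leq \cdots \leq n_k$. For a given $m\ge 0$, it has a solution if and only if $m\in\{0, 2, 4\}$. Moreover, the nontrivial solutions are exactly those given by \begin{align*} &L_2+1 = L_0^2,\quad L_0L_3+1 = L_0^3+1 = L_2^2,\\ &L_0^4L_2+1 = L_0^2L_2L_3+1 = L_2L_3^2+1 = L_4^2. \end{align*}
   Context: $(L_n)_{n\ge 0}$ is the Lucas sequence: $L_0=2$, $L_1=1$, $L_n=L_{n-1}+L_{n-2}$ for $n\ge 2$. A solution is a tuple $(m,k,n_1,\dots,n_k)$; the indices $n_i$ need not be distinct, and in a displayed solution a power $L_n^a$ on the left-hand side means that the index $n$ occurs $a$ times among $n_1,\dots,n_k$ (so each displayed product, with factors sorted by index, specifies a tuple). A solution is called nontrivial if either $k=1$, or $k\geq 2$ and $n_j\neq 1$ for every $j\in\{1,2,\ldots,k\}$. *)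

(* Defs.v *)
From mathcomp Require Import all_boot.
Set Implicit Arguments.
Unset Strict Implicit.
Unset Printing Implicit Defensive.

Fixpoint lucas (n : nat) : nat :=
  match n with
  | 0 => 2
  | 1 => 1
  | (n2.+1 as n1).+1 => lucas n1 + lucas n2
  end.

Definition is_solution (m k : nat) (n : k.-tuple nat) : Prop :=
  [/\ 1 <= k, sorted leq n
    & \prod_(i < k) lucas (tnth n i) + 1 = lucas m ^ 2].

Definition nontrivial (k : nat) (n : k.-tuple nat) : Prop :=
  k = 1 \/ (2 <= k /\ forall j : 'I_k, tnth n j <> 1).

(* A solution with left-hand side L_a^p L_b^q ... is listed as m together with
   the nondecreasing sequence of indices in which a occurs p times, b occurs
   q times, and so on; the length of that sequence is k. *)
Definition listed_solutions : seq (nat * seq nat) :=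
  [:: (0, [:: 2]);
      (2, [:: 0; 3]);
      (2, [:: 0; 0; 0]);
      (4, [:: 0; 0; 0; 0; 2]);
      (4, [:: 0; 0; 2; 3]);
      (4, [:: 2; 3; 3])].

(* Main.v *)
(* For odd m, 5 divides L_m^2 - 1 but no Lucas number.  For even m = 2^f q with
   q odd, L_q^2 + 1 = L_2q - 1 = F_3q / F_q divides L_m^2 - 1; if q > 1 it has
   an odd prime factor, which divides a Fibonacci number of odd index and hence
   no Lucas number.  If m = 2h with h >= 4 a power of 2, an odd prime factor p
   of L_h^2 - 3 = L_3h / L_h divides some factor L_n of the product, and
   comparing 2-adic valuations of indices shows that n is an odd multiple of h.
   Thus L_h divides L_m^2 - 1 = (L_h^2 - 2)^2 - 1, hence L_h divides 3, which is
   absurd.  Only m = 0, 2, 4 remain. *)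
Require Import Defs.
From mathcomp Require Import all_boot.
From mathcomp Require Import zify.

(** * Fibonacci numbers and identities linking them to Lucas numbers *)

Fixpoint fib (n : nat) : nat :=
  match n with
  | 0 => 0
  | 1 => 1
  | (n2.+1 as n1).+1 => fib n1 + fib n2
  end.

Lemma fibSS n : fib n.+2 = fib n.+1 + fib n. Proof. by []. Qed.

Lemma lucasSS n : lucas n.+2 = lucas n.+1 + lucas n. Proof. by []. Qed.

Lemma nat_ind2 (P : nat -> Prop) :
  P 0 -> P 1 -> (forall n, P n -> P n.+1 -> P n.+2) -> forall n, P n.
Proof.
move=> P0 P1 PSS n; suff: P n /\ P n.+1 by case.
by elim: n => [|n [Pn PSn]]; split=> //; apply: PSS.
Qed.

Lemma fib_addS a b : fib (a + b).+1 = fib a.+1 * fib b.+1 + fib a * fib b.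
Proof.
elim/nat_ind2: a => [||a IH0 IH1]; rewrite ?add0n ?add1n.
- by rewrite /= mul1n mul0n addn0.
- by rewrite fibSS /= !mul1n.
by rewrite !addSn fibSS -addSn IH1 IH0 !fibSS; lia.
Qed.

(** Both sides satisfy the Fibonacci recurrence in [a], so [a = 0] and [a = 1] decide; the factor 2
    avoids halves. *)
Lemma fib_add a b : 2 * fib (a + b) = fib a * lucas b + lucas a * fib b.
Proof.
elim/nat_ind2: a => [||a IH0 IH1].
- by rewrite add0n /= mul0n.
- elim/nat_ind2: b => // b; rewrite !add1n !fibSS !lucasSS /=; lia.
by rewrite !addSn fibSS -addSn mulnDr IH0 IH1 fibSS lucasSS; lia.
Qed.

Lemma lucas_add a b : 2 * lucas (a + b) = lucas a * lucas b + 5 * fib a * fib b.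
Proof.
elim/nat_ind2: a => [||a IH0 IH1].
- by rewrite add0n /= muln0 addn0.
- elim/nat_ind2: b => // b; rewrite !add1n !fibSS !lucasSS /=; lia.
by rewrite !addSn lucasSS -addSn mulnDr IH0 IH1 fibSS lucasSS; lia.
Qed.

Lemma lucas_add_fib n : lucas n + fib n = 2 * fib n.+1.
Proof. by rewrite -(add1n n) fib_add /= !mul1n. Qed.

(** This is L_n^2 - 5 F_n^2 = 4 (-1)^n, with the sign term moved to whichever side keeps it in
    [nat]. *)
Lemma lucas_sqr n : lucas n ^ 2 + 4 * odd n = 5 * fib n ^ 2 + 4 * ~~ odd n.
Proof.
elim: n => // n IH.
have F2 : (2 * fib n.+1) ^ 2 = (lucas n + fib n) ^ 2 by rewrite lucas_add_fib.
have L2 : (2 * lucas n.+1) ^ 2 = (lucas n + 5 * fib n) ^ 2.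
  by rewrite -(add1n n) lucas_add /= mul1n muln1.
by move: IH F2 L2; rewrite /=; case: (odd n) => /=; lia.
Qed.

Lemma fib_double n : fib (2 * n) = fib n * lucas n.
Proof. by have := fib_add n n; rewrite addnn -mul2n; lia. Qed.

Lemma lucas_double_even n : ~~ odd n -> lucas (2 * n) + 2 = lucas n ^ 2.
Proof.
move=> /negPf on; have := lucas_sqr n; have := lucas_add n n.
by rewrite on addnn -mul2n /=; lia.
Qed.

Lemma lucas_double_odd n : odd n -> lucas (2 * n) = lucas n ^ 2 + 2.
Proof.
move=> on; have := lucas_sqr n; have := lucas_add n n.
by rewrite on addnn -mul2n /=; lia.
Qed.

Lemma fib_triple_odd n : odd n -> fib (3 * n) = fib n * (lucas n ^ 2 + 1).
Proof.
move=> on; have := fib_add n (2 * n).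
by rewrite -mulSn fib_double lucas_double_odd //; lia.
Qed.

Lemma lucas_triple_even n :
  ~~ odd n -> lucas (3 * n) + 3 * lucas n = lucas n ^ 3.
Proof.
move=> on; have := lucas_add n (2 * n); rewrite -mulSn fib_double.
have L2 := congr1 (muln (lucas n)) (lucas_double_even _ on).
have := congr1 (muln (lucas n)) (lucas_sqr n).
by move: L2; rewrite (negPf on) /=; lia.
Qed.

Lemma lucas_add_double h a :
  ~~ odd h -> lucas (a + 2 * h) + lucas a = lucas h * lucas (a + h).
Proof.
move=> oh; have L2 := lucas_double_even _ oh.
elim/nat_ind2: a => [||a IH0 IH1]; first by rewrite !add0n /=; lia.
  have := lucas_add 1 (2 * h); have := congr1 (muln (lucas h)) (lucas_add 1 h).
  by rewrite fib_double /=; lia.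
by rewrite !addSn !lucasSS -!addSn; move: IH0 IH1; lia.
Qed.

Lemma lucas_dvd_odd_mul h t : ~~ odd h -> lucas h %| lucas (h * t.*2.+1).
Proof.
move=> oh; elim: t => [|t IH]; first by rewrite muln1.
have ->: h * t.+1.*2.+1 = h * t.*2.+1 + 2 * h by lia.
by rewrite -(dvdn_addl _ IH) lucas_add_double // dvdn_mulr.
Qed.

(** * Growth and residues modulo 5 of Lucas numbers *)

Lemma lucas_gt0 n : 0 < lucas n.
Proof. by elim/nat_ind2: n => // n L0 L1; rewrite lucasSS addn_gt0 L1. Qed.

Lemma lucas_leS n : lucas n.+1 <= lucas n.+2.
Proof. by rewrite lucasSS leq_addr. Qed.

(** Index 0 is excluded because L_0 = 2 exceeds L_1 = 1. *)
Lemma lucas_leq m n : 0 < m -> m <= n -> lucas m <= lucas n.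
Proof.
case: m => // m _; elim: n => // n IH; rewrite leq_eqVlt => /predU1P[<- //|].
case: n IH => // n IH le_mn; exact: leq_trans (IH le_mn) (lucas_leS n).
Qed.

(** Period 4; pairs of consecutive residues make the induction go through, and the default of [nth]
    is never reached. *)
Lemma lucas_mod5 n :
  (lucas n %% 5, lucas n.+1 %% 5) =
  nth (0, 0) [:: (2, 1); (1, 3); (3, 4); (4, 2)] (n %% 4).
Proof.
elim: n => // n; have: n %% 4 < 4 by rewrite ltn_mod.
rewrite lucasSS -(addn1 n) -(modnDml n) -(modnDm (lucas (n + 1))) addn1.
by case: (n %% 4) => [|[|[|[|]]]] //= _ [-> ->].
Qed.

Lemma lucas_ndvd5 n : ~~ (5 %| lucas n).
Proof.
have: n %% 4 < 4 by rewrite ltn_mod.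
rewrite /dvdn; move: (lucas_mod5 n).
by case: (n %% 4) => [|[|[|[|]]]] //= [-> _].
Qed.

Lemma lucas_sqr_mod5 n : odd n -> lucas n ^ 2 = 1 %[mod 5].
Proof.
move=> on; have: (n %% 4 < 4) && odd (n %% 4) by lia.
rewrite -modnXm; move: (lucas_mod5 n).
by case: (n %% 4) => [|[|[|[|]]]] //= [-> _].
Qed.

(** * Divisors of Fibonacci numbers and gcds of indices *)

Lemma coprime_fibS n : coprime (fib n) (fib n.+1).
Proof. by elim: n => // n IH; rewrite fibSS /coprime gcdnDl gcdnC. Qed.

(** Modulo F_b, F_(a+b) is F_a F_(b+1), and F_(b+1) is coprime to F_b. *)
Lemma dvd_fib_sub d a b : d %| fib (a + b) -> d %| fib b -> d %| fib a.
Proof.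
case: a => [|a]; first by rewrite dvdn0.
rewrite addSn fib_addS => dvd_ab dvd_b.
move: dvd_ab; rewrite (dvdn_addl _ (dvdn_mull _ dvd_b)) Gauss_dvdl //.
exact: coprime_dvdl dvd_b (coprime_fibS b).
Qed.

Lemma dvd_fib_mul d a t : d %| fib a -> d %| fib (t * a).
Proof.
move=> da; elim: t => [|t IH]; first by rewrite dvdn0.
case: a da IH => [|a] da IH; first by rewrite muln0.
by rewrite mulSn addSn fib_addS dvdn_add // ?(dvdn_mulr _ da) ?dvdn_mull.
Qed.

Lemma dvd_fib_trans d a b : a %| b -> d %| fib a -> d %| fib b.
Proof. by case/dvdnP=> t ->; apply: dvd_fib_mul. Qed.

(** Euclid's algorithm by subtraction, run on the indices. *)
Lemma dvd_fib_gcd d a b : d %| fib a -> d %| fib b -> d %| fib (gcdn a b).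
Proof.
have [n] := ubnP (a + b); elim: n a b => // n IH a b.
wlog le_ab: a b / a <= b => [wl lt_n da db|].
  case: (leqP a b) => [|/ltnW] le; first exact: wl.
  by rewrite gcdnC; apply: wl; rewrite 1?addnC.
case: a le_ab => [|a] le_ab lt_n da db; first by rewrite gcd0n.
rewrite -(subnK le_ab) gcdnDr; apply: IH => //; first by lia.
by apply: dvd_fib_sub da; rewrite subnK.
Qed.

Lemma dvd_lucas_fib d n : d %| lucas n -> d %| fib n -> d %| 2.
Proof.
move=> dL dF.
have cop : coprime d (fib n.+1) := coprime_dvdl dF (coprime_fibS n).
by rewrite -(Gauss_dvdl _ cop) -lucas_add_fib dvdn_add.
Qed.

(** * Odd prime divisors of Lucas numbers *)

Section OddPrime.

Variables (p : nat) (pr_p : prime p) (odd_p : odd p).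

Lemma ndvd_lucas_fib n : p %| lucas n -> ~~ (p %| fib n).
Proof.
move=> pL; apply/negP => /(dvd_lucas_fib _ _ pL).
by rewrite dvdn_prime2 // => /eqP p2; move: odd_p; rewrite p2.
Qed.

Lemma dvd_fib_double n : p %| lucas n -> p %| fib (2 * n).
Proof. by move=> pL; rewrite fib_double dvdn_mull. Qed.

(** Otherwise p divides F_a and F_(2n), hence F_g with g = gcd(a, 2n) = gcd(a, n), hence F_n as well
    as L_n. *)
Lemma ndvd_lucas_fib_odd a n : odd a -> p %| fib a -> ~~ (p %| lucas n).
Proof.
move=> oa pF; apply/negP => pL; case/negP: (ndvd_lucas_fib n pL).
have := dvd_fib_gcd _ _ _ pF (dvd_fib_double n pL).
rewrite Gauss_gcdr ?coprimen2 //; exact: dvd_fib_trans (dvdn_gcdr _ _).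
Qed.

(** With h = 2^e and g = gcd(3h, n), p divides F_(2g). If h does not divide n, then 2g divides 3h;
    if n/h is even, then 2g divides n. Either way p divides both F and L at one index. *)
Lemma dvd_lucas_index e n : p %| lucas (3 * 2 ^ e) -> p %| lucas n ->
  exists t, n = 2 ^ e * t.*2.+1.
Proof.
move=> pL3 pLn; set h := 2 ^ e.
have := dvd_fib_gcd _ _ _ (dvd_fib_double _ pL3) (dvd_fib_double _ pLn).
rewrite -muln_gcdr -/h => pFg.
have [/dvdnP[q n_qh] | hn] := boolP (h %| n); last first.
  have /dvdn_pfactor[//|i le_ie g_2i] : gcdn h n %| 2 ^ e by apply: dvdn_gcdl.
  have lt_ie : i < e.
    rewrite ltn_neqAle le_ie andbT; apply: contraNneq hn => i_e.
    by rewrite /h -i_e -g_2i dvdn_gcdr.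
  case/negP: (ndvd_lucas_fib _ pL3); apply: dvd_fib_trans pFg.
  apply: (@dvdn_trans (3 * 2 ^ i.+1)); last by rewrite dvdn_pmul2l // dvdn_exp2l.
  rewrite expnS mulnCA dvdn_pmul2l // -g_2i muln_gcdr dvdn_gcd dvdn_gcdl.
  by rewrite (dvdn_trans (dvdn_gcdr _ _)) ?dvdn_mull.
exists q./2; rewrite n_qh mulnC; congr (_ * _).
suff oq : odd q by rewrite -[LHS]odd_double_half oq.
apply: contraT => /negPf oq.
have q2 : q = 2 * q./2 by rewrite -[LHS]odd_double_half oq; lia.
case/negP: (ndvd_lucas_fib _ pLn); apply: dvd_fib_trans pFg.
rewrite n_qh -muln_gcdl mulnA dvdn_mul // q2 Gauss_gcdr //.
by rewrite dvdn_pmul2l // dvdn_gcdr.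
Qed.

End OddPrime.

(** * Factors of L_m^2 - 1 and the possible values of m *)

Lemma odd_prime_dvd x : 2 < x -> ~~ (4 %| x) ->
  exists2 p, prime p & odd p && (p %| x).
Proof.
move=> x_gt2 x4.
have [u [ou u_gt1 ux]] : exists u, [/\ odd u, 1 < u & u %| x].
  have [ox|ox] := boolP (odd x); first by exists x; split=> //; lia.
  exists x./2; split; [lia | lia | apply/dvdnP; exists 2; lia].
exists (pdiv u); first exact: pdiv_prime.
by rewrite (dvdn_odd (pdiv_dvd u)) // (dvdn_trans (pdiv_dvd u)).
Qed.

Lemma pow2_odd m : 0 < m -> exists e t, m = 2 ^ e * t.*2.+1.
Proof.
move=> m_gt0; exists (logn 2 m), (m %/ 2 ^ logn 2 m)./2.
have [//|u cop ->] := pfactor_coprime (p := 2) _ m_gt0.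
move: cop; rewrite coprime2n => ou.
have u_gt0 : 0 < u by case: u ou.
rewrite lognM ?expn_gt0 // pfactorK // (@lognE 2 u).
have -> : (2 %| u) = false by rewrite dvdn2 ou.
rewrite !andbF add0n mulnK ?expn_gt0 // mulnC; congr (_ * _).
by rewrite -[LHS]odd_double_half ou.
Qed.

Lemma lucas_sqr_dvd_pow2 m f : ~~ odd m -> 0 < m ->
  lucas m ^ 2 - 1 %| lucas (2 ^ f * m) ^ 2 - 1.
Proof.
move=> om m_gt0; elim: f => [|f IH]; first by rewrite mul1n.
apply: dvdn_trans IH _; rewrite (expnS 2 f) -mulnA; set n := 2 ^ f * m.
have on : ~~ odd n by rewrite oddM (negPf om) andbF.
(* As L_2n = L_n^2 - 2, L_2n^2 - 1 = (L_n^2 - 3)(L_n^2 - 1); positivity of L_2n keeps the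
   subtraction exact. *)
apply/dvdnP; exists (lucas n ^ 2 - 3).
have := lucas_double_even _ on; have := lucas_gt0 (2 * n); nia.
Qed.

Lemma lucas_odd_dvd n : odd n -> lucas n ^ 2 + 1 %| lucas (2 * n) ^ 2 - 1.
Proof.
move=> on; apply/dvdnP; exists (lucas n ^ 2 + 3).
by have := lucas_double_odd _ on; nia.
Qed.

Lemma sqr_add1_ndvd4 y : ~~ (4 %| y ^ 2 + 1).
Proof. by rewrite -(odd_double_half y) -muln2; case: (odd y) => /=; lia. Qed.

(** Squares are 0 or 1 modulo 4; for y < 2 the truncated difference would be 0. *)
Lemma sqr_sub3_ndvd4 y : 1 < y -> ~~ (4 %| y ^ 2 - 3).
Proof. by rewrite -(odd_double_half y) -muln2; case: (odd y) => /=; nia. Qed.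

Lemma lucas_prod_index m (s : seq nat) :
  \prod_(n <- s) lucas n + 1 = lucas m ^ 2 -> m \in [:: 0; 2; 4].
Proof.
move=> eq_prod; set P := \prod_(n <- s) lucas n in eq_prod.
have P_eq : lucas m ^ 2 - 1 = P by rewrite -eq_prod addnK.
have dvd_factor n : n \in s -> lucas n %| P.
  by move=> sn; rewrite /P (big_rem n sn) dvdn_mulr.
have prime_factor p : prime p -> p %| P -> exists2 n, n \in s & p %| lucas n.
  move=> pr_p; rewrite /P Euclid_dvd_prod // big_has => /hasP[n sn pn].
  by exists n.
have [om|om] := boolP (odd m).
  have : 5 %| P by have := lucas_sqr_mod5 m om; rewrite -eq_prod; lia.
  by case/(prime_factor 5)=> // n _; rewrite (negPf (lucas_ndvd5 n)).
have [-> //|m_gt0] := posnP m.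
have [[|e] [t m_et]] := pow2_odd m m_gt0.
  by move: om; rewrite m_et mul1n /= odd_double.
have [t0|t_gt0] := posnP t; last first.
  set q := t.*2.+1 in m_et; have oq : odd q by rewrite /= odd_double.
  have Lq : 4 <= lucas q by apply: (lucas_leq 3); lia.
  have [|p pr_p /andP[op pq]] := odd_prime_dvd (lucas q ^ 2 + 1) _ (sqr_add1_ndvd4 _).
    by nia.
  have [|n _ pn] := prime_factor p pr_p.
    (* The chain is L_q^2 + 1, then L_2q^2 - 1, then repeated doubling from the even index 2q up to
       m. *)
    apply: (dvdn_trans pq); apply: dvdn_trans (lucas_odd_dvd q oq) _.
    rewrite -P_eq m_et (expnSr 2 e) -mulnA lucas_sqr_dvd_pow2 //; lia.
  suff /negP[] : ~~ (p %| lucas n) by [].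
  apply: (ndvd_lucas_fib_odd p pr_p op (3 * q)); first by rewrite oddM.
  by rewrite fib_triple_odd // dvdn_mull.
(* The exponents 1 and 2 give m = 2 and m = 4; beyond them m = 2h with h >= 4. *)
move: m_et; rewrite t0 muln1 => m_e; case: e m_e => [|[|e]] m_e; rewrite ?m_e //.
set h := 2 ^ e.+2.
have m_h : m = 2 * h by rewrite m_e expnS.
have h_ge4 : 4 <= h by rewrite /h !expnS; have := expn_gt0 2 e; lia.
have oh : ~~ odd h by rewrite oddX.
have Lh : 7 <= lucas h by apply: (lucas_leq 4).
have [||p pr_p /andP[op ph]] := odd_prime_dvd (lucas h ^ 2 - 3).
- by nia.
- by apply: sqr_sub3_ndvd4; lia.
have L2h := lucas_double_even h oh.
have [|n sn pn] := prime_factor p pr_p.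
  apply: (dvdn_trans ph); apply/dvdnP; exists (lucas h ^ 2 - 1).
  by rewrite -P_eq m_h; nia.
have [|t' n_h] := dvd_lucas_index p pr_p op e.+2 n _ pn.
  apply: (dvdn_trans ph); apply/dvdnP; exists (lucas h).
  by have := lucas_triple_even h oh; rewrite -/h; nia.
have : lucas h %| P.
  apply: dvdn_trans (dvd_factor n sn); rewrite n_h; exact: lucas_dvd_odd_mul.
(* Expanding (L_h^2 - 2)^2 - 1 leaves remainder 3 modulo L_h, while L_h >= 7. *)
have -> : P = (lucas h * (lucas h ^ 2 - 4)) * lucas h + 3 by rewrite -P_eq m_h; nia.
by rewrite dvdn_addr ?dvdn_mull // => /dvdn_leq; lia.
Qed.

(** * Finite search for the solutions avoiding index 1 *)

Fixpoint words (T : Type) (alphabet : seq T) (k : nat) : seq (seq T) :=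
  if k is k'.+1 then [seq x :: w | x <- alphabet, w <- words T alphabet k']
  else [:: [::]].

Lemma mem_words (T : eqType) (alphabet w : seq T) :
  all (mem alphabet) w -> w \in words T alphabet (size w).
Proof.
elim: w => //= x w IH /andP[xa wa].
by apply/allpairsP; exists (x, w); split=> //; apply: IH.
Qed.

Lemma lucas_dvd_index n : lucas n %| 48 -> n <= 3.
Proof.
move=> dvd48; have L_le := dvdn_leq (isT : 0 < 48) dvd48.
(* L_9 = 76 exceeds 48, so only nine indices need checking. *)
have lt_n9 : n < 9.
  rewrite ltnNge; apply/negP => /(lucas_leq 9 n isT).
  by rewrite leqNgt (leq_ltn_trans L_le).
by move: n dvd48 lt_n9 {L_le}; do 9![case=> //].
Qed.

Lemma lucas_ge2 n : n != 1 -> 2 <= lucas n.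
Proof. by case: n => [|[|n]] // _; apply: leq_trans (lucas_leq 2 n.+2 _ _). Qed.

Lemma exp2_size_leq_lucas_prod (s : seq nat) :
  1 \notin s -> 2 ^ size s <= \prod_(n <- s) lucas n.
Proof.
elim: s => [|x s IH]; first by rewrite big_nil.
rewrite inE negb_or eq_sym => /andP[x1 s1]; rewrite big_cons expnS.
by rewrite leq_mul ?lucas_ge2 ?IH.
Qed.

Lemma lucas_prod_solutions m (s : seq nat) :
    \prod_(n <- s) lucas n + 1 = lucas m ^ 2 -> 1 \notin s -> sorted leq s ->
  (m, s) \in listed_solutions.
Proof.
move=> eq_prod s1 sorted_s; have m_in := lucas_prod_index m s eq_prod.
(* For m = 0, 2, 4 the product is 3, 8, 48, all divisors of 48. *)
have P48 : \prod_(n <- s) lucas n %| 48.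
  have -> : \prod_(n <- s) lucas n = lucas m ^ 2 - 1 by rewrite -eq_prod addnK.
  by move: m_in; rewrite !inE => /or3P[] /eqP->.
have letters : all (mem [:: 0; 2; 3]) s.
  apply/allP => x sx; have x1 : x != 1 by apply: contraNneq s1 => <-.
  have : x <= 3.
    by apply: lucas_dvd_index; apply: dvdn_trans P48; rewrite (big_rem x sx) dvdn_mulr.
  by case: x x1 {sx} => [|[|[|[|]]]].
(* Every factor is at least 2, and 48 < 2^6. *)
have size_s : size s < 6.
  have := leq_trans (exp2_size_leq_lucas_prod s s1) (dvdn_leq (isT : 0 < 48) P48).
  by rewrite -[48]/48 => le48; rewrite -(ltn_exp2l _ _ (isT : 1 < 2)); apply: leq_ltn_trans le48 _.
(* The product is written with [foldr] so that the exhaustive check runs by computation. *)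
pose listed w := all (fun i => [&& sorted leq w
    & foldr muln 1 (map lucas w) + 1 == lucas i ^ 2]
    ==> ((i, w) \in listed_solutions)) [:: 0; 2; 4].
have checked : all (fun k => all listed (words nat [:: 0; 2; 3] k)) (iota 0 6).
  by vm_compute.
have /allP/(_ _ (mem_words _ _ _ letters)) : all listed (words nat [:: 0; 2; 3] (size s)).
  by move/allP: checked; apply; rewrite mem_iota.
move/allP/(_ m m_in)/implyP; apply; rewrite sorted_s foldrE big_map.
exact/eqP.
Qed.

(** * Transfer from sequences to tuples *)

Lemma prod_tnth_lucas k (n : k.-tuple nat) :
  \prod_(i < k) lucas (tnth n i) = \prod_(x <- n) lucas x.
Proof. by rewrite (big_tuple _ _ n xpredT lucas). Qed.

Lemma listed_is_solution m k (n : k.-tuple nat) :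
  (m, tval n) \in listed_solutions -> is_solution m n.
Proof.
move=> listed_n; rewrite /is_solution prod_tnth_lucas -(big_map lucas xpredT id) -foldrE.
split; [rewrite -(size_tuple n) | | ]; move: listed_n;
  by rewrite !inE => /or4P[|||/or3P[]] /eqP[? n_eq]; subst m; rewrite ?n_eq.
Qed.

Lemma listed_nontrivial m k (n : k.-tuple nat) :
  (m, tval n) \in listed_solutions -> nontrivial n.
Proof.
move=> listed_n; have [k1|k_neq1] := eqVneq k 1; [by left | right].
have [k_gt0 _ _] := listed_is_solution m k n listed_n.
split=> [|j nj]; first by rewrite ltn_neqAle eq_sym k_neq1.
have n1 : 1 \in tval n by rewrite -nj mem_tnth.
by move: listed_n n1; rewrite !inE => /or4P[|||/or3P[]] /eqP[_ ->].
Qed.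

(** Nontriviality alone permits index 1 when k = 1, but L_1 + 1 = 2 is not a square. *)
Lemma nontrivial_notin1 m k (n : k.-tuple nat) :
  is_solution m n -> nontrivial n -> 1 \notin tval n.
Proof.
case=> _ _; rewrite prod_tnth_lucas => eq_prod nontriv; apply/negP => n1.
case: nontriv => [k1|[_ n_neq1]]; last first.
  by have [i n_i] := tnthP _ _ n1; apply: (n_neq1 i).
subst k; move: n n1 eq_prod; case=> [[|x []]] //= _.
rewrite inE big_seq1 => /eqP <-; have := lucas_gt0 m.
by case: (lucas m) => [|[|l]] // _; rewrite -mulnn /=; nia.
Qed.

Theorem theorem9 :
  (forall m : nat,
     (exists (k : nat) (n : k.-tuple nat), is_solution m n) <->
     m \in [:: 0; 2; 4]) /\
  (forall (m k : nat) (n : k.-tuple nat),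
     (is_solution m n /\ nontrivial n) <->
     (m, tval n) \in listed_solutions).
Proof.
split=> [m|m k n].
  split=> [[k [n [_ _]]]|]; first by rewrite prod_tnth_lucas; apply: lucas_prod_index.
  rewrite !inE => /or3P[] /eqP->; [exists 1, [tuple 2] | exists 2, [tuple 0; 3]
    | exists 3, [tuple 2; 3; 3]]; exact: listed_is_solution.
split=> [[sol nontriv]|listed_n]; last first.
  by split; [apply: listed_is_solution | apply: listed_nontrivial listed_n].
have [_ sorted_n eq_prod] := sol; rewrite prod_tnth_lucas in eq_prod.
by apply: lucas_prod_solutions eq_prod _ sorted_n; apply: nontrivial_notin1 sol nontriv.
Qed.
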